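(* Let $L$ be a complete lattice with at least two elements satisfying $x\wedge\bigvee_{j\in J}y_j=\bigvee_{j\in J}(x\wedge y_j)$ for all $x$ and all families $(y_j)_{j\in J}$ in $L$ (equivalently, $L$ is the lattice reduct of a complete Heyting algebra). Then for every type $\tau$ and every relational structure $\mathfrak{X}$ of type $\tau$, the convolution algebras $L^{\mathfrak{X}}$ and $2^{\mathfrak{X}}$ satisfy exactly the same equations built from variables using the binary operations $\wedge,\vee$, the constants $0,1$, and the operation symbols $f_i$ $(i\in I)$.
   Context: A type is a function $\tau:I\to\mathbb{N}$; write $n_i=\tau(i)$. A relational structure of type $\tau$ is $\mathfrak{X}=(X,(R_i)_{i\in I})$ where $X$ is a set and $R_i\subseteq X^{n_i+1}$. For a complete lattice $L$, the convolution algebra $L^{\mathfrak{X}}$ consists of the set $L^X$ of all functions $X\to L$, with componentwise (pointwise) lattice operations $\wedge,\vee$ and constant functions $0,1$, together with, for each $i\in I$, the $n_i$-ary operation $f_i(\alpha_1,\ldots,\alpha_{n_i})(x)=\bigvee\{\alpha_1(x_1)\wedge\cdots\wedge\alpha_{n_i}(x_{n_i}):(x_1,\ldots,x_{n_i},x)\in R_i\}$ (for $n_i=0$ the empty meet is $1$). $2$ denotes the two-element lattice $\{0,1\}$. *)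

(* Defs.v *)
From mathcomp Require Import all_boot all_order.
From mathcomp Require Import boolp classical_sets.

Set Implicit Arguments.
Unset Strict Implicit.
Unset Printing Implicit Defensive.

Local Open Scope classical_set_scope.
Local Open Scope order_scope.

(* [tbLatticeType] requires a choice operator on the carrier; with the
   classical axioms of [boolp] every type has one, so this is no restriction. *)
Definition complete_lattice d (L : tbLatticeType d) : Prop :=
  forall A : set L, supremums A !=set0.

(* [supremum \bot A] is [\bot] for A empty, so in a complete lattice this is the
   join of an arbitrary set. *)
Definition bigjoin d (L : tbLatticeType d) (A : set L) : L := supremum \bot A.

Definition meet_bigjoin_distributive d (L : tbLatticeType d) : Prop :=
  forall (x : L) (J : Type) (y : J -> L),
    Order.meet x (bigjoin (range y)) =
    bigjoin (range (fun j => Order.meet x (y j))).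

Section Algebras.
Variables (I : Type) (tau : I -> nat).

Record algebra := Algebra {
  carrier :> Type;
  alg_meet : carrier -> carrier -> carrier;
  alg_join : carrier -> carrier -> carrier;
  alg_zero : carrier;
  alg_one : carrier;
  alg_op : forall i, ('I_(tau i) -> carrier) -> carrier
}.

Inductive term :=
| TVar of nat
| TMeet of term & term
| TJoin of term & term
| TZero
| TOne
| TOp i of ('I_(tau i) -> term).

Fixpoint eval (A : algebra) (v : nat -> A) (t : term) : A :=
  match t with
  | TVar p => v p
  | TMeet s t => alg_meet (eval v s) (eval v t)
  | TJoin s t => alg_join (eval v s) (eval v t)
  | TZero => alg_zero A
  | TOne => alg_one A
  | TOp i ts => alg_op (fun k => eval v (ts k))
  end.

Definition satisfies (A : algebra) (s t : term) : Prop :=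
  forall v : nat -> A, eval v s = eval v t.

Record structure := Structure {
  points :> Type;
  rel_of : forall i, set ((tau i).+1.-tuple points)
}.

Definition conv_op d (L : tbLatticeType d) (X : structure) (i : I)
    (alpha : 'I_(tau i) -> X -> L) : X -> L :=
  fun x => bigjoin
    [set \meet_(k < tau i) alpha k (tnth xs k)
      | xs in [set xs : (tau i).-tuple X | rel_of (rcons_tuple xs x)]].

Definition conv_algebra d (L : tbLatticeType d) (X : structure) : algebra :=
  {| carrier := X -> L;
     alg_meet := fun a b x => Order.meet (a x) (b x);
     alg_join := fun a b x => Order.join (a x) (b x);
     alg_zero := fun=> \bot;
     alg_one := fun=> \top;
     alg_op := @conv_op d L X |}.

End Algebras.

(* Main.v *)
(* Every value of a term in [L^X] is a join of finite meets of values of the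
   valuation: [t(v)(x)] is the join of [/\_{(p,y) in F} v_p(y)] over those
   finite sets [F] of pairs (variable, point) whose indicator, read as a
   valuation in [2^X], makes [t] true at [x].  Existence of these finite
   witnesses is where distributivity enters.  As the index set only depends on
   the value of [t] in [2^X], equations pass from [2^X] to [L^X]; conversely
   [2^X] is a subalgebra of [L^X]. *)
From Stdlib Require List.
Require Import Defs.
From mathcomp Require Import all_boot all_order.
From mathcomp Require Import boolp classical_sets.

Set Implicit Arguments.
Unset Strict Implicit.
Unset Printing Implicit Defensive.

Import Order.Theory.
Local Open Scope classical_set_scope.
Local Open Scope order_scope.

Section BigJoin.
Variables (d : Order.disp_t) (L : tbLatticeType d).
Hypothesis Lcomplete : complete_lattice L.

Lemma bigjoin_supremums (A : set L) : supremums A (bigjoin A).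
Proof.
rewrite /bigjoin /supremum; have [x Ax] := Lcomplete A.
(* For empty [A] the default [\bot] is the least upper bound; otherwise [xget] returns a member of
   [supremums A], inhabited by [x]. *)
case: eqP => [->|_]; first by split=> // y _; apply: le0x.
by case: xgetP => [//|/(_ x)].
Qed.

Lemma bigjoin_ub (A : set L) (a : L) : A a -> a <= bigjoin A.
Proof. by move=> Aa; case: (bigjoin_supremums A) => + _; apply. Qed.

Lemma bigjoin_le (A : set L) (z : L) :
  (forall a, A a -> a <= z) -> bigjoin A <= z.
Proof. by move=> Az; case: (bigjoin_supremums A) => _; apply. Qed.

Hypothesis Ldistr : meet_bigjoin_distributive L.

Lemma meet_bigjoin_le (x z : L) (A : set L) :
  (forall a, A a -> Order.meet x a <= z) -> Order.meet x (bigjoin A) <= z.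
Proof.
move=> Az.
(* Distributivity is stated for indexed families, so [A] is indexed by its own elements. *)
have -> : A = range (fun j : {a | A a} => sval j).
  apply/seteqP; split=> [a Aa|_ [[a Aa] _ <-] //].
  by exists (exist _ a Aa).
rewrite Ldistr; apply: bigjoin_le => _ [[a Aa] _ <-]; exact: Az.
Qed.

Lemma bigjoin_meet_le (A B : set L) (z : L) :
  (forall a b, A a -> B b -> Order.meet a b <= z) ->
  Order.meet (bigjoin A) (bigjoin B) <= z.
Proof.
move=> ABz; apply: meet_bigjoin_le => b Bb.
rewrite meetC; apply: meet_bigjoin_le => a Aa.
by rewrite meetC; apply: ABz.
Qed.

End BigJoin.

Lemma complete_lattice_bool : complete_lattice bool.
Proof.
move=> A; exists `[< A true >]; split=> [[] Aa //|b ub].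
  by rewrite (asboolT Aa).
by case: asboolP => // /ub.
Qed.

Lemma bigjoin_boolP (A : set bool) : bigjoin A <-> A true.
Proof.
split=> [|At].
  apply: contraPP => nAt.
  have : bigjoin A <= false.
    by apply: (bigjoin_le complete_lattice_bool) => -[].
  by case: (bigjoin A).
by have := bigjoin_ub complete_lattice_bool At; case: (bigjoin A).
Qed.

Lemma bigmeet_boolP n (f : 'I_n -> bool) :
  \meet_(k < n) f k <-> forall k, f k.
Proof.
split=> [fn k|fk]; last first.
  by elim/big_rec: _ => // k b _ ->; rewrite fk.
by have := @meets_inf _ _ _ k xpredT f isT; rewrite fn; case: (f k). 
Qed.

Section Convolution.
Variables (d : Order.disp_t) (L : tbLatticeType d).
Hypothesis Lcomplete : complete_lattice L.
Variables (I : Type) (tau : I -> nat) (X : structure tau).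

Notation evalL := (@eval I tau (conv_algebra L X)).
Notation eval2 := (@eval I tau (conv_algebra bool X)).

Lemma eval2_opP (w : nat -> X -> bool) i (ts : 'I_(tau i) -> term tau) (x : X) :
  eval2 w (TOp ts) x <->
  exists2 xs : (tau i).-tuple X, rel_of (rcons_tuple xs x) &
    forall k, eval2 w (ts k) (tnth xs k).
Proof.
rewrite /= /conv_op; split=> [/bigjoin_boolP[xs Rxs]|[xs Rxs Txs]].
  by move=> e; exists xs => //; apply/bigmeet_boolP; rewrite e.
by apply/bigjoin_boolP; exists xs => //; apply/bigmeet_boolP.
Qed.

Lemma conv_op_ub i (alpha : 'I_(tau i) -> X -> L) (xs : (tau i).-tuple X) x :
  rel_of (rcons_tuple xs x) ->
  \meet_(k < tau i) alpha k (tnth xs k) <= conv_op alpha x.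
Proof. by move=> Rxs; apply: bigjoin_ub => //; exists xs. Qed.

Lemma conv_op_le i (alpha : 'I_(tau i) -> X -> L) x z :
  (forall xs : (tau i).-tuple X, rel_of (rcons_tuple xs x) ->
     \meet_(k < tau i) alpha k (tnth xs k) <= z) ->
  conv_op alpha x <= z.
Proof. by move=> le_z; apply: bigjoin_le => // _ [xs Rxs <-]; apply: le_z. Qed.

(** Terms contain no complement, so every operation is monotone. This lets a witness [F] be enlarged
    to [F ++ G]. *)
Lemma eval2_mono (w w' : nat -> X -> bool) (t : term tau) (x : X) :
  (forall p y, w p y -> w' p y) -> eval2 w t x -> eval2 w' t x.
Proof.
move=> ww'; elim: t x => [p|s IHs t IHt|s IHs t IHt|||i ts IH] x //=.
- exact: ww'.
- by move=> /andP[/IHs sx /IHt tx]; apply/andP.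
- by move=> /orP[/IHs|/IHt] e; apply/orP; [left|right].
- move=> /eval2_opP[xs Rxs Txs]; apply/eval2_opP; exists xs => // k.
  exact: IH.
Qed.

Definition bool_embed (b : bool) : L := if b then \top else \bot.

(** The map [bool_embed] preserves finite meets and arbitrary joins, hence acts pointwise as a
    homomorphism of convolution algebras. *)
Lemma eval_bool_embed (w : nat -> X -> bool) (t : term tau) (x : X) :
  evalL (fun p y => bool_embed (w p y)) t x = bool_embed (eval2 w t x).
Proof.
elim: t x => [p|s IHs t IHt|s IHs t IHt|||i ts IH] x //=.
- rewrite IHs IHt; case: (eval2 w s x); case: (eval2 w t x);
    by rewrite /= ?meet1x ?meet0x.
- rewrite IHs IHt; case: (eval2 w s x); case: (eval2 w t x);
    by rewrite /= ?join1x ?join0x.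
- apply/le_anti/andP; split.
    apply: conv_op_le => xs Rxs.
    (* Either [xs] makes all arguments true and the right-hand side is [\top], or one factor of the
       meet is [\bot]. *)
    have [/forallP Txs|] := boolP [forall k, eval2 w (ts k) (tnth xs k)].
      have /eval2_opP /= -> : exists2 xs : (tau i).-tuple X,
        rel_of (rcons_tuple xs x) & forall k, eval2 w (ts k) (tnth xs k).
        by exists xs.
      exact: lex1.
    rewrite negb_forall => /existsP[k /negbTE wk].
    by apply: (@meets_max _ _ _ k) => //; rewrite IH wk le0x.
  case e : (conv_op _ x) => /=; last exact: le0x.
  have /eval2_opP[xs Rxs Txs] : eval2 w (TOp ts) x by [].
  apply: le_trans (conv_op_ub _ Rxs); apply: meets_ge => k _.
  by rewrite IH Txs.
Qed.

Variable v : nat -> X -> L.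

(** [List.In] with classical truth values is used because the points form an arbitrary type, without
    boolean equality. *)
Definition indicator (F : seq (nat * X)) (p : nat) (y : X) : bool :=
  `[< List.In (p, y) F >].

Definition meet_values (F : seq (nat * X)) : L := \meet_(q <- F) v q.1 q.2.

Lemma indicator_catl F G p y : indicator F p y -> indicator (F ++ G) p y.
Proof.
by move=> /asboolP Fp; apply/asboolP/List.in_or_app; left.
Qed.

Lemma indicator_catr F G p y : indicator G p y -> indicator (F ++ G) p y.
Proof.
by move=> /asboolP Fp; apply/asboolP/List.in_or_app; right.
Qed.

Lemma meet_values_le F p y : indicator F p y -> meet_values F <= v p y.
Proof.
rewrite /meet_values => /asboolP; elim: F => //= q F IH [->|/IH le_v].
  by rewrite big_cons leIl.
by rewrite big_cons; apply: le_trans le_v; rewrite leIr.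
Qed.

Definition witnesses (t : term tau) (x : X) : set (seq (nat * X)) :=
  [set F | eval2 (indicator F) t x].

(** Truth of [t] under [indicator F] selects a disjunct at each join and a tuple at each operation;
    the same choices give the bound in [L]. *)
Lemma meet_values_le_eval F (t : term tau) (x : X) :
  witnesses t x F -> meet_values F <= evalL v t x.
Proof.
rewrite /witnesses /=.
elim: t x => [p|s IHs t IHt|s IHs t IHt|||i ts IH] x //=.
- exact: meet_values_le.
- by move=> /andP[/IHs sx /IHt tx]; rewrite lexI sx.
- by move=> /orP[/IHs|/IHt] le_e; apply: le_trans le_e _; rewrite ?leUl ?leUr.
- move=> /eval2_opP[xs Rxs Txs].
  apply: le_trans (conv_op_ub _ Rxs); apply: meets_ge => k _.
  exact: IH.
Qed.

Hypothesis Ldistr : meet_bigjoin_distributive L.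

(** Distributivity picks one witness per [k]; their concatenation serves every [k] by monotonicity,
    and its value is the meet of theirs. Lists [r] allow induction; the operation case takes all of
    ['I_(tau i)]. *)
Lemma bigmeet_witnesses_le (K : eqType) (r : seq K) (ts : K -> term tau)
    (y : K -> X) :
  \meet_(k <- r) bigjoin (meet_values @` witnesses (ts k) (y k)) <=
  bigjoin (meet_values @`
    [set F | forall k, k \in r -> witnesses (ts k) (y k) F]).
Proof.
elim: r => [|k r IH].
  rewrite big_nil; apply: bigjoin_ub => //; exists [::] => //.
  by rewrite /meet_values big_nil.
rewrite big_cons; apply: le_trans (leI2 (lexx _) IH) _.
apply: bigjoin_meet_le => // _ _ [F Fk <-] [G Gr <-].
apply: bigjoin_ub => //; exists (F ++ G); last by rewrite /meet_values big_cat.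
move=> j; rewrite inE => /predU1P[->|/Gr Gj].
  by apply: eval2_mono Fk => p z; apply: indicator_catl.
by apply: eval2_mono Gj => p z; apply: indicator_catr.
Qed.

Lemma eval_bigjoin_witnesses (t : term tau) (x : X) :
  evalL v t x = bigjoin (meet_values @` witnesses t x).
Proof.
apply/le_anti/andP; split; last first.
  by apply: bigjoin_le => // _ [F Fx <-]; apply: meet_values_le_eval.
(* In this direction distributivity is applied at meets and at the operations. *)
elim: t x => [p|s IHs t IHt|s IHs t IHt|||i ts IH] x /=.
- apply: bigjoin_ub => //; exists [:: (p, x)].
    by apply/asboolP; left.
  by rewrite /meet_values big_seq1.
- apply: le_trans (leI2 (IHs x) (IHt x)) _.
  apply: bigjoin_meet_le => // _ _ [F Fs <-] [G Gt <-].
  apply: bigjoin_ub => //; exists (F ++ G); last by rewrite /meet_values big_cat.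
  apply/andP; split.
    by apply: eval2_mono Fs => p z; apply: indicator_catl.
  by apply: eval2_mono Gt => p z; apply: indicator_catr.
- rewrite leUx; apply/andP; split; [move: (IHs x)|move: (IHt x)] => le_e;
    apply: le_trans le_e _; apply: bigjoin_le => // _ [F Fx <-];
    apply: bigjoin_ub => //; exists F => //; apply/orP; by [left|right].
- exact: le0x.
- apply: bigjoin_ub => //; exists [::] => //.
  by rewrite /meet_values big_nil.
- apply: conv_op_le => xs Rxs.
  apply: (@le_trans _ _ (\meet_(k < tau i)
    bigjoin (meet_values @` witnesses (ts k) (tnth xs k)))).
    by elim/big_ind2: _ => // a b a' b' ab ab'; exact: leI2.
  apply: le_trans (bigmeet_witnesses_le _ _ _) _.
  apply: bigjoin_le => // _ [F Fxs <-]; apply: bigjoin_ub => //.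
  exists F => //; apply/eval2_opP; exists xs => // k.
  by apply: Fxs; rewrite mem_index_enum.
Qed.

End Convolution.

Theorem theorem4p11 (d : Order.disp_t) (L : tbLatticeType d)
  (Lcomplete : complete_lattice L)
  (Lnontrivial : exists x y : L, x <> y)
  (Ldistr : meet_bigjoin_distributive L)
  (I : Type) (tau : I -> nat) (X : structure tau) (s t : term tau) :
  satisfies (conv_algebra L X) s t <-> satisfies (conv_algebra bool X) s t.
Proof.
split=> [Lst w|st v]; apply/funext => x.
  (* The equation is tested only on valuations with values in [\bot] and [\top]. *)
  have := congr1 (@^~ x) (Lst (fun p y => bool_embed L (w p y))).
  rewrite !eval_bool_embed //.
  have L01 : \bot <> \top :> L.
    move=> L01; have [a [b]] := Lnontrivial; apply.
    have all0 (c : L) : c = \bot by apply/le_anti; rewrite le0x L01 lex1.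
    by rewrite (all0 a) (all0 b).
  have inj : injective (bool_embed L) by case=> [] [] //= e; case: L01.
  exact: inj.
rewrite !eval_bigjoin_witnesses //; congr (bigjoin (_ @` _)).
(* The equation in [bool], taken at the valuation [indicator F], says that [F] witnesses [s] at [x]
   exactly when it witnesses [t] there. *)
by apply/seteqP; split=> F; rewrite /witnesses /= st.
Qed.
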